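(* Consider the priority assignment that sets, for each item $x\in[n]$, $\mathrm{pri}_x:=-\lfloor \log_2 (1/\mathbf{p}_x)\rfloor+\delta_x$ with $\delta_x\sim U(0,1)$ independent, where $\mathbf{p}$ is a probability distribution on $[n]$ (items with $\mathbf{p}_x=0$ receive priority $-\infty$, i.e. lower than all others), and let $T$ be the resulting Treap. There exists a distribution $\mathbf{p}$ on $[n]$ such that $\mathbb{E}_{x\sim\mathbf{p}}[\mathrm{depth}(x)]=\Omega(\log^2 n)$.
   Context: A Treap with distinct priorities is the unique binary search tree on the ordered keys $[n]$ in which every node's priority is at least the priorities of its descendants. $\mathrm{depth}(x)$ is the number of ancestors of $x$ in $T$ (including $x$). The expectation is over both $x\sim\mathbf{p}$ and the random offsets. *)

(* Defs.v *)
From mathcomp Require Import all_boot all_order all_algebra.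
From mathcomp Require Import all_classical all_reals all_analysis.
From mathcomp Require Import zify.

Set Implicit Arguments.
Unset Strict Implicit.
Unset Printing Implicit Defensive.

Import Order.TTheory GRing.Theory Num.Theory.

Local Open Scope classical_set_scope.
Local Open Scope ring_scope.

(* The key set [n] is 'I_n, i.e. {0, ..., n-1} with its usual order. *)
Inductive tree (n : nat) : Type :=
| Leaf : tree n
| Node : tree n -> 'I_n -> tree n -> tree n.

Arguments Leaf {n}.

Fixpoint keys n (t : tree n) : seq 'I_n :=
  if t is Node l k r then keys l ++ k :: keys r else [::].

Fixpoint is_bst n (t : tree n) : bool :=
  if t is Node l k r then
    [&& all (fun y : 'I_n => (y < k)%N) (keys l),
        all (fun y : 'I_n => (k < y)%N) (keys r), is_bst l & is_bst r]
  else true.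

(* [ancestor t y x]: the subtree of [t] rooted at [y] contains [x]; every node
   of [t] is thus an ancestor of itself. *)
Fixpoint ancestor n (t : tree n) (y x : 'I_n) : bool :=
  if t is Node l k r then
    [|| (y == k) && (x \in keys t), ancestor l y x | ancestor r y x]
  else false.

Definition depth n (t : tree n) (x : 'I_n) : nat :=
  #|[set y | ancestor t y x]%SET|.

Definition is_treap (R : realType) n (pri : 'I_n -> \bar R) (t : tree n) :
    Prop :=
  [/\ is_bst t,
      forall x, x \in keys t &
      forall x y, ancestor t y x -> (pri x <= pri y)%E].

Lemma ancestor_keys n (t : tree n) x y :
  ancestor t y x -> (y \in keys t) && (x \in keys t).
Proof.
elim: t => //= l IHl k r IHr; rewrite !mem_cat !inE.
case/or3P => [/andP[/eqP-> ->]|/IHl/andP[-> ->]//|/IHr/andP[-> ->]].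
  by rewrite eqxx orbT.
by rewrite !orbT.
Qed.

Lemma treap_exists (R : realType) n (pri : 'I_n -> \bar R) :
  exists t, is_treap pri t.
Proof.
suff H m a b : (b - a <= m)%N -> exists t : tree n,
    [/\ is_bst t, forall x : 'I_n, (x \in keys t) = (a <= x < b)%N &
        forall x y, ancestor t y x -> (pri x <= pri y)%E].
  have [t [t1 t2 t3]] := H n 0%N n (leq_subr _ _).
  by exists t; split=> // x; rewrite t2 ltn_ord.
elim: m a b => [|m IH] a b hm.
  exists Leaf; split=> // x; apply/esym/negbTE.
  by move: hm; rewrite leqn0 subn_eq0; lia.
have [[k0 hk0]|none] := pselect (exists k : 'I_n, (a <= k < b)%N); last first.
  exists Leaf; split=> // x; apply/esym/negbTE/negP => hx.
  by apply: none; exists x.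
case: (@arg_maxP _ _ _ k0 (fun k : 'I_n => a <= k < b)%N pri hk0) => k hk kmax.
have [l [l1 l2 l3]] : exists t : tree n,
    [/\ is_bst t, forall x : 'I_n, (x \in keys t) = (a <= x < k)%N &
        forall x y, ancestor t y x -> (pri x <= pri y)%E].
  by apply: IH; lia.
have [r [r1 r2 r3]] : exists t : tree n,
    [/\ is_bst t, forall x : 'I_n, (x \in keys t) = (k.+1 <= x < b)%N &
        forall x y, ancestor t y x -> (pri x <= pri y)%E].
  by apply: IH; lia.
have keysE x : (x \in keys (Node l k r)) = (a <= x < b)%N.
  rewrite /= mem_cat inE l2 r2 -val_eqE /=; lia.
exists (Node l k r); split=> //.
- apply/and4P; split=> //; apply/allP => y; rewrite ?l2 ?r2; lia.
- move=> x y /or3P[/andP[/eqP->]|/l3//|/r3//].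
  by rewrite keysE => /kmax.
Qed.

(* The treap is unique as soon as the priorities are distinct ([treap_unique]);
   when several keys share a priority, [treap] is one of the possible treaps,
   which depends only on how the priorities compare ([treap_order]). *)
Definition treap (R : realType) n (pri : 'I_n -> \bar R) : tree n :=
  sval (cid (treap_exists pri)).

Lemma treapP (R : realType) n (pri : 'I_n -> \bar R) : is_treap pri (treap pri).
Proof. exact: svalP (cid (treap_exists pri)). Qed.

Lemma treap_unique (R : realType) n (pri : 'I_n -> \bar R) (t : tree n) :
  injective pri -> is_treap pri t -> t = treap pri.
Proof.
move=> inj [b k h]; have [b' k' h'] := treapP pri.
have e : keys t =i keys (treap pri) by move=> x; rewrite k k'.
elim: t (treap pri) b {k} h b' {k'} h' e => [|l IHl x r IHr] [|l' y r'] //=.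
- by move=> _ _ _ _ /(_ y); rewrite mem_cat !inE eqxx orbT.
- by move=> _ _ _ _ /(_ x); rewrite mem_cat !inE eqxx orbT.
move=> /and4P[/allP xl /allP xr bl br] h /and4P[/allP yl /allP yr bl' br'] h' e.
have exy : x = y.
  apply/inj/le_anti/andP; split.
    apply: h'; rewrite eqxx /= -e mem_cat !inE eqxx orbT //.
  by apply: h; rewrite eqxx /= e mem_cat !inE eqxx orbT.
subst y.
congr Node; [apply: IHl|apply: IHr] => //.
- by move=> u v uv; apply: h; rewrite uv !orbT.
- by move=> u v uv; apply: h'; rewrite uv !orbT.
- move=> z; have := e z; rewrite !mem_cat !inE.
  have := xl z; have := xr z; have := yl z; have := yr z.
  case: eqVneq => [->|_]; first by rewrite ltnn; do 4 case: (_ \in _) => //;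
    do ?[move=> /(_ isT)]; lia.
  by do 4 case: (_ \in _) => //; do ?[move=> /(_ isT)]; lia.
- by move=> u v uv; apply: h; rewrite uv !orbT.
- by move=> u v uv; apply: h'; rewrite uv !orbT.
- move=> z; have := e z; rewrite !mem_cat !inE.
  have := xl z; have := xr z; have := yl z; have := yr z.
  case: eqVneq => [->|_]; first by rewrite ltnn; do 4 case: (_ \in _) => //;
    do ?[move=> /(_ isT)]; lia.
  by do 4 case: (_ \in _) => //; do ?[move=> /(_ isT)]; lia.
Qed.

Lemma treap_order (R : realType) n (pri pri' : 'I_n -> \bar R) :
  (forall x y, (pri x <= pri y)%E = (pri' x <= pri' y)%E) ->
  treap pri = treap pri'.
Proof.
move=> e; rewrite /treap.
move: (treap_exists pri) (treap_exists pri').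
have -> : is_treap pri = is_treap pri'.
  apply/funext => t; apply/propext; split=> -[b k h]; split=> // x y /h;
  by rewrite e.
by move=> e1 e2; rewrite (Prop_irrelevance e1 e2).
Qed.

Definition is_distribution (R : realType) n (p : 'I_n -> R) : Prop :=
  (forall x, 0 <= p x) /\ \sum_(x < n) p x = 1.

Definition log2 (R : realType) (x : R) : R := ln x / ln 2.

Definition priority (R : realType) n (p delta : 'I_n -> R) (x : 'I_n) : \bar R :=
  if p x == 0 then -oo%E
  else (- (Num.floor (log2 (1 / p x)))%:~R + delta x)%:E.

Definition mutually_independent d (Omega : measurableType d) (R : realType)
    (P : probability Omega R) n (X : 'I_n -> {RV P >-> R}) : Prop :=
  forall (J : {set 'I_n}) (A : 'I_n -> set R),
    (forall i, measurable (A i)) ->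
    P (\bigcap_(i in [set` J]) (X i @^-1` A i))
      = (\prod_(i in J) P (X i @^-1` A i))%E.

Definition uniform01 d (Omega : measurableType d) (R : realType)
    (P : probability Omega R) (X : {RV P >-> R}) : Prop :=
  forall A : set R, measurable A ->
    distribution P X A = uniform_prob (ltr01 : 0 < 1 :> R) A.

(* The expectation is over x ~ p and the offsets, x being independent of the
   offsets. The integrand is measurable: by [treap_order], it is determined by
   the finitely many comparisons between priorities. *)
Definition expected_depth d (Omega : measurableType d) (R : realType)
    (P : probability Omega R) n (p : 'I_n -> R)
    (delta : 'I_n -> {RV P >-> R}) : \bar R :=
  expectation P (fun w => \sum_(x < n)
    p x * (depth (treap (priority p (fun y => delta y w))) x)%:R).

(* Main.v *)
(* The keys are laid out from left to right in t layers of 2^t keys each, the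
   keys of layer i having weight 2^-(2t+1+i), followed by a bottom block sharing
   the remaining mass (at least 1/2) uniformly. Every layer has higher
   priorities than everything on its right, so a key y of a layer is an ancestor
   of all bottom keys as soon as it beats the later keys of its own layer. If k
   bounds the number of those keys, this has probability of order 1/k: with
   s = 1/(2k), it suffices that the offset of y exceeds 1 - s and that the other
   k offsets are below 1 - s. Summing over a layer gives a harmonic sum of order
   t, and over the t layers an expected depth of order t^2, where t is of order
   log n. *)

Require Import Defs.
From mathcomp Require Import all_boot all_order all_algebra.
From mathcomp Require Import all_classical all_reals all_analysis.
From mathcomp Require Import measurable_realfun.
From mathcomp Require Import zify ring lra.

Set Implicit Arguments.
Unset Strict Implicit.
Unset Printing Implicit Defensive.

Import Order.TTheory GRing.Theory Num.Theory.

Local Open Scope classical_set_scope.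
Local Open Scope ring_scope.

(** * Ancestors in heap-ordered search trees *)

(** Induction on the tree. A root [k] other than [y] has priority at least that of [y], so it cannot
    lie in the range from [y] (excluded) to [x]; hence [y] and [x] fall in the same subtree. *)
Lemma ancestor_of_max_left (R : realType) n (pri : 'I_n -> \bar R)
    (t : tree n) (y x : 'I_n) :
  is_bst t -> (forall u v, ancestor t v u -> (pri u <= pri v)%E) ->
  y \in keys t -> x \in keys t -> (y < x)%N ->
  (forall z : 'I_n, (y < z <= x)%N -> (pri z < pri y)%E) ->
  ancestor t y x.
Proof.
elim: t => //= l IHl k r IHr /and4P[/allP lk /allP kr bl br] heap yt xt yx ymax.
have [yk|yNk] := eqVneq y k; first by rewrite xt.
move: (xt) (yt); rewrite !mem_cat !inE (negbTE yNk) /=.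
have k_anc : y \in keys l ++ k :: keys r -> (pri y <= pri k)%E.
  by move=> yt'; apply: heap; rewrite eqxx yt'.
have max_k : ~~ (y < k <= x)%N.
  by apply/negP => /ymax; rewrite ltNge k_anc.
case: eqVneq => [xk|xNk] /=.
  by move=> _ /orP[/lk|/kr]; move: max_k yx; rewrite xk; clear; lia.
move=> /orP[xl|xr] /orP[yl|yr].
- rewrite IHl //= => u v uv; by apply: heap; rewrite uv orbT.
- by move: (lk _ xl) (kr _ yr) yx; clear; lia.
- by move: (lk _ yl) (kr _ xr) max_k; clear; lia.
- rewrite IHr ?orbT //= => u v uv; by apply: heap; rewrite uv !orbT.
Qed.

Lemma treap_ancestor_of_max_left (R : realType) n (pri : 'I_n -> \bar R)
    (y x : 'I_n) : (y < x)%N ->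
  (forall z : 'I_n, (y < z <= x)%N -> (pri z < pri y)%E) ->
  ancestor (treap pri) y x.
Proof. by have [b k h] := treapP pri; exact: ancestor_of_max_left. Qed.

(** * Uniform law, product inequality and harmonic sums *)

Lemma uniform_prob01_itvoo (R : realType) (a b : R) :
  0 <= a -> a <= b -> b <= 1 ->
  uniform_prob (ltr01 : 0 < 1 :> R) `]a, b[%classic = (b - a)%:E.
Proof.
move=> a0 ab b1; rewrite /uniform_prob integral_uniform_pdf setIidl; last first.
  move=> x /=; rewrite !in_itv /=; lra.
rewrite (eq_integral (cst 1%:E)); last first.
  move=> x; rewrite inE /= in_itv /= => /andP[ax xb].
  by rewrite /uniform_pdf subr0 invr1 ifT//; lra.
rewrite integral_cst //= mul1e lebesgue_measure_itv /= lte_fin.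
(* An empty interval gets measure 0, which agrees with [b - a] because then [a = b]. *)
case: ltP => //= ba.
have -> : a = b by lra.
by rewrite subrr.
Qed.

Lemma prod_one_minus_ge (R : realDomainType) (I : Type) (r : seq I) (P : pred I)
    (a : I -> R) : (forall i, 0 <= a i <= 1) ->
  1 - \sum_(i <- r | P i) a i <= \prod_(i <- r | P i) (1 - a i).
Proof.
(* The induction on this Weierstrass inequality also carries the sign of the partial sum, which
   controls the cross term in [(1 - b) * (1 - x)]. *)
move=> a01; suff /andP[] : [&& 1 - \sum_(i <- r | P i) a i <=
    \prod_(i <- r | P i) (1 - a i), 0 <= \sum_(i <- r | P i) a i &
    0 <= \prod_(i <- r | P i) (1 - a i) ] by [].
apply: (big_rec2 (fun x y => [&& 1 - x <= y, 0 <= x & 0 <= y])) => [|i x y _].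
  by rewrite subr0 !lexx ler01.
by have := a01 i; set b := a i => b01 h; apply/and3P; split; nra.
Qed.

(** Dyadic grouping: the [2 ^ t] terms with [2 ^ t <= j < 2 ^ t.+1] are each at least
    [1 / 2 ^ t.+1], so doubling the range adds at least 1/2. *)
Lemma harmonic_sum_pow2_ge (R : realFieldType) t :
  t%:R / 2 <= \sum_(0 <= j < 2 ^ t) (j.+1%:R : R)^-1.
Proof.
elim: t => [|t IH]; first by rewrite mul0r sumr_ge0.
rewrite (big_cat_nat (n := (2 ^ t)%N)) //=; last by rewrite leq_exp2l.
rewrite -natr1 mulrDl lerD //.
have : \sum_(2 ^ t <= j < 2 ^ t.+1) ((2 ^ t.+1)%:R : R)^-1 <=
    \sum_(2 ^ t <= j < 2 ^ t.+1) (j.+1%:R)^-1.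
  rewrite !big_nat; apply: ler_sum => j /andP[_ jt].
  by rewrite lef_pV2 ?posrE ?ltr0n ?expn_gt0 // ler_nat.
apply: le_trans; rewrite sumr_const_nat expnS mul2n -addnn addnK addnn -mul2n.
have p0 : (2 ^ t)%:R != 0 :> R by rewrite pnatr_eq0 -lt0n expn_gt0.
by rewrite natrM -[leRHS]mulr_natl invfM [leRHS]mulrCA divff // mulr1 mul1r.
Qed.

(* The integral of a nonnegative function is by definition the supremum of the
   integrals of the simple functions below it, measurable or not. *)
Lemma ge0_le_integral_nonmeasurable d (T : measurableType d) (R : realType)
    (mu : {measure set T -> \bar R}) (f g : T -> \bar R) :
  (forall x, 0 <= f x)%E -> (forall x, f x <= g x)%E ->
  (\int[mu]_x f x <= \int[mu]_x g x)%E.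
Proof.
move=> f0 fg; rewrite !ge0_integralTE //; last first.
  by move=> x; exact: le_trans (f0 x) (fg x).
apply: ereal_sup_le => _ [h hf <-]; exists h => // x.
exact: le_trans (hf x) (fg x).
Qed.

(** Along each block of [m] consecutive keys, [m - y %% m] runs down from [m] to 1, so every block
    gives a reversed harmonic sum. *)
Lemma harmonic_sum_blocks (R : realType) n t m : (t * m <= n)%N ->
  \sum_(y < n | (y < t * m)%N) ((m - y %% m)%:R : R)^-1 =
  t%:R * \sum_(0 <= j < m) (j.+1%:R)^-1.
Proof.
move=> tmn; have [->|m0] := posnP m.
  by rewrite muln0 big_pred0 // big_nil mulr0.
rewrite big_ord_narrow //= -(big_mkord xpredT (fun y => ((m - y %% m)%:R)^-1)).
rewrite big_nat_mul.
rewrite (eq_bigr (fun=> \sum_(0 <= j < m) (j.+1%:R)^-1)); last first.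
  move=> i _; rewrite -{1}[(i * m)%N]add0n big_addn mulSn addnK.
  rewrite [RHS]big_nat_rev !big_nat; apply: eq_bigr => j /andP[_ jm].
  by rewrite addnC modnMDl modn_small // add0n subnSK.
by rewrite sumr_const_nat subn0 mulr_natl.
Qed.

(** * Record events and their probability *)

(** The uniform law confines offsets to ]0, 1[ only almost surely. Imposing it on the remaining keys
    costs no probability and makes later comparisons of priorities hold pointwise. *)
Definition record_itv (R : realType) n (y : 'I_n) (S : {set 'I_n}) (s : R)
    (z : 'I_n) : set R :=
  [set` if z == y then `]1 - s, 1[ else if z \in S then `]0, 1 - s[
        else `]0, 1[].

Definition record_event d (Omega : measurableType d) (R : realType)
    (P : probability Omega R) n (delta : 'I_n -> {RV P >-> R}) (y : 'I_n)
    (S : {set 'I_n}) (s : R) : set Omega :=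
  \bigcap_(z in [set` [set: 'I_n]%SET]) (delta z @^-1` record_itv y S s z).

Lemma measurable_record_event d (Omega : measurableType d) (R : realType)
    (P : probability Omega R) n (delta : 'I_n -> {RV P >-> R}) y S s :
  measurable (record_event delta y S s).
Proof.
apply: fin_bigcap_measurable => // z _.
apply: measurable_funPTI.
by exact: measurable_itv.
Qed.

Lemma record_event_prob_ge d (Omega : measurableType d) (R : realType)
    (P : probability Omega R) n (delta : 'I_n -> {RV P >-> R}) (y : 'I_n)
    (S : {set 'I_n}) (k : nat) :
  mutually_independent delta -> (forall x, uniform01 (delta x)) ->
  y \notin S -> (0 < k)%N -> (#|S| <= k)%N ->
  ((k%:R^-1 / 4)%:E <= P (record_event delta y S (k%:R^-1 / 2)))%E.
Proof.
move=> ind unif yS k0 Sk; set s : R := k%:R^-1 / 2.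
have k1 : 1 <= k%:R :> R by rewrite ler1n.
have s01 : 0 <= s <= 1.
  have : k%:R^-1 <= 1 :> R by rewrite invf_le1 //; lra.
  have : 0 <= k%:R^-1 :> R by rewrite invr_ge0; lra.
  by rewrite /s; lra.
have mA z : measurable (record_itv y S s z).
  by exact: measurable_itv.
rewrite /record_event ind //.
(* [a z] is the probability that the constraint on [z] fails. The factor of [y] is [s]; the others
   multiply to at least [1 - k * s = 1 / 2]. *)
pose a z := if z == y then 1 - s else if z \in S then s else 0.
have a01 z : 0 <= a z <= 1.
  by rewrite /a; case: ifP => _; [|case: ifP => _]; lra.
have PA z : P (delta z @^-1` record_itv y S s z) = (1 - a z)%:E.
  rewrite -[LHS]/(distribution P (delta z) _) unif // /record_itv /a.
  case: ifP => _; first by rewrite uniform_prob01_itvoo //; lra.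
  by case: ifP => _; rewrite uniform_prob01_itvoo ?subr0 //; lra.
rewrite (eq_bigr (fun z => (1 - a z)%:E)) => [|z _]; last exact: PA.
rewrite prodEFin lee_fin (bigD1 y) ?inE //= {1}/a eqxx subKr.
have : \sum_(z in [set: 'I_n]%SET | z != y) a z <= 1 / 2.
  apply: (@le_trans _ _ (\sum_(z in S) s)).
    rewrite big_mkcond [leRHS]big_mkcond /=; apply: ler_sum => z _.
    rewrite inE /= /a; case: eqVneq => [->|_] /=; first by rewrite (negbTE yS).
    by case: ifP => // _; lra.
  rewrite sumr_const -[leLHS]mulr_natl /s mulrA ler_pM2r //.
  by rewrite ler_pdivrMr ?mul1r ?ler_nat // ltr0n.
have := @prod_one_minus_ge R _ (index_enum 'I_n)
  (fun z => (z \in [set: 'I_n]%SET) && (z != y)) a a01.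
have -> : k%:R^-1 / 4 = s * (1 / 2) by rewrite /s; field; lra.
move=> h1 h2; apply: ler_wpM2l; first by case/andP: s01.
apply: le_trans h1; have -> : 1 / 2 = 1 - 1 / 2 :> R by field.
by rewrite lerD2l lerN2.
Qed.

Lemma log2_exp2 (R : realType) k : log2 (2 ^+ k : R) = k%:R.
Proof.
rewrite /log2 lnXn // -[ln 2 *+ k]mulr_natl mulfK //.
by rewrite gt_eqF // ln_gt0 // ltr1n.
Qed.

Lemma ler_log2 (R : realType) (x y : R) : 0 < x -> x <= y -> log2 x <= log2 y.
Proof.
move=> x0 xy; rewrite /log2 ler_pM2r; last by rewrite invr_gt0 ln_gt0 // ltr1n.
by rewrite ler_ln // posrE (lt_le_trans x0).
Qed.

(** * The layered distribution and its levels *)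

Section layered.
Context (R : realType) (n t : nat).

Definition nlayered : nat := (t * 2 ^ t)%N.

Definition layered_weight (x : 'I_n) : R := (2 ^+ (2 * t + 1 + x %/ 2 ^ t))^-1.

Definition layered_mass : R := \sum_(x < n | (x < nlayered)%N) layered_weight x.

Definition layered (x : 'I_n) : R :=
  if (x < nlayered)%N then layered_weight x
  else (1 - layered_mass) / (n - nlayered)%:R.

Context (tn : (2 ^ (5 * t) <= n)%N) (t_gt0 : (0 < t)%N).

Lemma nlayered_le : (nlayered <= 2 ^ (2 * t))%N.
Proof. by rewrite mul2n -addnn expnD leq_mul2r ltnW ?orbT // ltn_expl. Qed.

(** This size forces bottom weights to at most [2^-(3t+1)], strictly below the lightest layer weight
    [2^-(3t)]. It follows from [n >= 2^(5t) >= 2 * 2^(4t)] and [nlayered <= 2^(4t)]. *)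
Lemma nbottom_ge : (2 ^ (3 * t + 1) <= n - nlayered)%N.
Proof.
have h1 := nlayered_le.
have h2 : (2 ^ (2 * t) <= 2 ^ (4 * t))%N by rewrite leq_exp2l; lia.
have h3 : (2 ^ (3 * t + 1) <= 2 ^ (4 * t))%N by rewrite leq_exp2l; lia.
have h4 : (2 ^ (4 * t + 1) <= 2 ^ (5 * t))%N by rewrite leq_exp2l; lia.
by move: h1 h2 h3 h4 tn; rewrite (addn1 (4 * t)) expnS; lia.
Qed.

Lemma nlayered_lt : (nlayered < n)%N.
Proof. by rewrite -subn_gt0; apply: leq_trans nbottom_ge; rewrite expn_gt0. Qed.

Lemma layered_mass_ge0 : 0 <= layered_mass.
Proof. by apply: sumr_ge0 => x _; rewrite invr_ge0 exprn_ge0. Qed.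

Lemma card_layered : #|[pred x : 'I_n | (x < nlayered)%N]| = nlayered.
Proof.
by rewrite -sum1_card (big_ord_narrow (ltnW nlayered_lt)) sum1_card card_ord.
Qed.

(** There are at most [2^(2t)] layered keys, each of weight at most [2^-(2t+1)]. *)
Lemma layered_mass_le : layered_mass <= 1 / 2.
Proof.
apply: (@le_trans _ _
    (\sum_(x < n | (x < nlayered)%N) ((2 ^+ (2 * t + 1))^-1 : R))).
  apply: ler_sum => x _; rewrite lef_pV2 ?posrE ?exprn_gt0 //.
  by rewrite ler_eXn2l ?ltr1n // leq_addr.
rewrite sumr_const card_layered -[leLHS]mulr_natl.
rewrite ler_pdivrMr ?exprn_gt0 // addn1 exprS mulrA divfK //.
by rewrite mul1r -natrX ler_nat nlayered_le.
Qed.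

Lemma layered_gt0 x : 0 < layered x.
Proof.
rewrite /layered; case: ifP => _; first by rewrite invr_gt0 exprn_gt0.
rewrite divr_gt0 ?ltr0n ?subn_gt0 ?nlayered_lt //.
by have := layered_mass_le; lra.
Qed.

Lemma layered_bottom_mass :
  \sum_(x < n | ~~ (x < nlayered)%N) layered x = 1 - layered_mass.
Proof.
have b0 : (n - nlayered)%:R != 0 :> R.
  by rewrite pnatr_eq0 -lt0n subn_gt0 nlayered_lt.
rewrite (eq_bigr (fun=> (1 - layered_mass) / (n - nlayered)%:R)); last first.
  by move=> x /negbTE; rewrite /layered => ->.
rewrite sumr_const -[#|_|]/(#|[predC [pred x : 'I_n | (x < nlayered)%N]]|).
have -> : #|[predC [pred x : 'I_n | (x < nlayered)%N]]| = (n - nlayered)%N.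
  have := cardC [pred x : 'I_n | (x < nlayered)%N].
  by rewrite card_layered card_ord => /(canRL (addKn _)) <-.
by rewrite -[LHS]mulr_natr divfK.
Qed.

Lemma layered_distribution : is_distribution layered.
Proof.
split=> [x|]; first exact/ltW/layered_gt0.
rewrite (bigID (fun x : 'I_n => (x < nlayered)%N)) /= layered_bottom_mass.
have -> : \sum_(x < n | (x < nlayered)%N) layered x = layered_mass.
  by apply: eq_bigr => x; rewrite /layered => ->.
by rewrite addrC subrK.
Qed.

Definition level (x : 'I_n) : int := Num.floor (log2 (1 / layered x)).

Lemma level_layered (x : 'I_n) : (x < nlayered)%N ->
  level x = (2 * t + 1 + x %/ 2 ^ t)%:Z.
Proof.
rewrite /level /layered => ->; rewrite div1r invrK log2_exp2.
by rewrite -[X in Num.floor X]/((2 * t + 1 + x %/ 2 ^ t)%:Z%:~R) intrKfloor.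
Qed.

Lemma level_bottom (x : 'I_n) : (nlayered <= x)%N ->
  (3 * t + 1)%:Z <= level x.
Proof.
move=> xN; rewrite /level floor_ge_int /layered ltnNge xN /=.
rewrite -[leLHS]/((3 * t + 1)%:R) -(@log2_exp2 R).
apply: ler_log2; rewrite ?exprn_gt0 // div1r invf_div.
rewrite ler_pdivlMr; last by have := layered_mass_le; lra.
apply: (@le_trans _ _ (2 ^+ (3 * t + 1) * 1)); last first.
  by rewrite mulr1 -natrX ler_nat nbottom_ge.
by rewrite ler_pM2l ?exprn_gt0 //; have := layered_mass_ge0; lra.
Qed.

(** A gap of one level is what offsets in ]0, 1[ cannot bridge. Layers have levels up to [3t], the
    bottom block at least [3t + 1]. *)
Lemma level_lt (y z : 'I_n) : (y < nlayered)%N -> (y < z)%N ->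
  (z %/ 2 ^ t)%N != (y %/ 2 ^ t)%N -> level y + 1 <= level z.
Proof.
move=> yN yz ne; rewrite (level_layered yN).
have yt : (y %/ 2 ^ t < t)%N by rewrite ltn_divLR ?expn_gt0.
have [zN|zN] := ltnP z nlayered; last by have := level_bottom zN; lia.
rewrite (level_layered zN).
by have := leq_div2r (2 ^ t) (ltnW yz); lia.
Qed.

End layered.

(** * Records of a layer are ancestors of the bottom block *)

Definition later_in_layer n t (y : 'I_n) : {set 'I_n} :=
  [set z : 'I_n | (y < z)%N && (z %/ 2 ^ t == y %/ 2 ^ t)%N]%SET.

(** The later keys lie between [y] and the end of its block. Counting [y] too keeps the bound
    positive for the last key of a layer, so that it can be inverted. *)
Lemma card_later_in_layer n t (y : 'I_n) :
  (#|later_in_layer t y| <= 2 ^ t - y %% 2 ^ t)%N.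
Proof.
rewrite cardE -(size_map val) -(size_iota y (_ - _)); apply: uniq_leq_size.
  by rewrite map_inj_uniq ?enum_uniq //; exact: val_inj.
move=> _ /mapP[z + ->]; rewrite mem_enum inE mem_iota => /andP[yz /eqP zy].
have := ltn_pmod z (expn_gt0 2 t); have := divn_eq z (2 ^ t).
have := divn_eq y (2 ^ t); rewrite zy /=; clear -yz; lia.
Qed.

(** On the event, [y] beats every key to its right: keys of its layer have the same level and a
    smaller offset, and all others lose at least one level while their offset stays below 1. *)
Lemma record_event_ancestor d (Omega : measurableType d) (R : realType)
    (P : probability Omega R) n t (delta : 'I_n -> {RV P >-> R})
    (y x : 'I_n) (s : R) (w : Omega) :
  (2 ^ (5 * t) <= n)%N -> (0 < t)%N -> 0 <= s <= 1 ->
  (y < nlayered t)%N -> (nlayered t <= x)%N ->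
  record_event delta y (later_in_layer t y) s w ->
  ancestor (treap (priority (layered R t) (fun z => delta z w))) y x.
Proof.
move=> tn t0 s01 yN xN wE.
have mem z : record_itv y (later_in_layer t y) s z (delta z w).
  by apply: wE; rewrite /= inE.
have prE z : priority (layered R t) (fun z => delta z w) z =
    (- (level R t z)%:~R + delta z w)%:E.
  by rewrite /priority gt_eqF // layered_gt0.
apply: treap_ancestor_of_max_left => [|z /andP[yz _]].
  exact: leq_trans yN xN.
rewrite !prE lte_fin.
have := mem y; rewrite /record_itv eqxx /= in_itv /= => /andP[dy _].
have zy : (z == y) = false by rewrite -val_eqE /= gtn_eqF.
have := mem z; rewrite /record_itv zy /=.
case: ifPn => zS; rewrite /= in_itv /= => /andP[_ dz].
  move: zS; rewrite inE => /andP[_ /eqP same].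
  (* [nlayered] is a multiple of [2 ^ t], so no block straddles its boundary. *)
  have zN : (z < nlayered t)%N.
    by rewrite /nlayered -ltn_divLR ?expn_gt0 // same ltn_divLR ?expn_gt0.
  by rewrite (level_layered R yN) (level_layered R zN) same; lra.
have lev : level R t y + 1 <= level R t z.
  by apply: level_lt => //; apply: contra zS => same; rewrite inE yz.
move: lev; rewrite -(ler_int R) intrD; lra.
Qed.

Lemma depth_ge_sum (R : realType) n (T : tree n) (x : 'I_n) (Q : pred 'I_n)
    (a : 'I_n -> R) :
  (forall y, a y <= (ancestor T y x)%:R) ->
  \sum_(y < n | Q y) a y <= (depth T x)%:R.
Proof.
move=> ha; rewrite /depth -sum1_card natr_sum.
rewrite big_mkcond [leRHS]big_mkcond /=; apply: ler_sum => y _.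
rewrite inE; case: ifP => _; last by case: ifP.
by apply: le_trans (ha y) _; case: ifP.
Qed.

(** * The lower bound on the expected depth *)

(** The constant is 1/2 (bottom mass) times 1/4 (from the record probability [1 / (4k)]) times 1/2
    (from the harmonic sum [t / 2]); the other factor [t] counts the layers. *)
Lemma expected_depth_layered_ge d (Omega : measurableType d) (R : realType)
    (P : probability Omega R) n t (delta : 'I_n -> {RV P >-> R}) :
  (2 ^ (5 * t) <= n)%N -> (0 < t)%N ->
  mutually_independent delta -> (forall x, uniform01 (delta x)) ->
  ((t%:R ^+ 2 / 16)%:E <= expected_depth (layered R t) delta)%E.
Proof.
move=> tn t0 ind unif; rewrite /expected_depth unlock.
pose k (y : 'I_n) := (2 ^ t - y %% 2 ^ t)%N.
have k0 y : (0 < k y)%N by rewrite subn_gt0 ltn_pmod ?expn_gt0.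
pose s (y : 'I_n) : R := (k y)%:R^-1 / 2.
have s01 y : 0 <= s y <= 1.
  have k1 : 1 <= (k y)%:R :> R by rewrite ler1n.
  have : (k y)%:R^-1 <= 1 :> R by rewrite invf_le1 //; lra.
  have : 0 <= (k y)%:R^-1 :> R by rewrite invr_ge0; lra.
  by rewrite /s; lra.
pose E (y : 'I_n) := record_event delta y (later_in_layer t y) (s y).
have mE y : measurable (E y) by exact: measurable_record_event.
(* A measurable minorant of the depth integrand: only bottom keys are searched, with mass at least
   1/2, and only layered ancestors are counted. *)
pose g (w : Omega) : R := \sum_(y < n | (y < nlayered t)%N) 2^-1 * \1_(E y) w.
have g0 w : 0 <= g w by apply: sumr_ge0 => y _; rewrite mulr_ge0.
apply: (@le_trans _ _ (\int[P]_w (g w)%:E)%E); last first.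
  apply: ge0_le_integral_nonmeasurable => w; rewrite lee_fin //.
  rewrite (bigID (fun x : 'I_n => (x < nlayered t)%N)) /= ler_wpDl //.
    by apply: sumr_ge0 => x _; rewrite mulr_ge0 // ltW ?layered_gt0.
  rewrite /g -mulr_sumr.
  apply: (@le_trans _ _ (\sum_(x < n | ~~ (x < nlayered t)%N) layered R t x *
      \sum_(y < n | (y < nlayered t)%N) \1_(E y) w)).
    rewrite -mulr_suml ler_wpM2r ?sumr_ge0 // layered_bottom_mass //.
    by have := layered_mass_le R tn t0; lra.
  apply: ler_sum => x; rewrite -leqNgt => xN.
  rewrite ler_wpM2l ?(ltW (layered_gt0 _ _ _ _)) //.
  (* With the restriction moved into the summand, the term is 0 off the layers and the comparison
     with [ancestor] holds for every [y]. *)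
  rewrite big_mkcond /=; apply: depth_ge_sum => y.
  case: ifP => // yN; rewrite indicE.
  case: (boolP (w \in E y)) => // /set_mem wE.
  by rewrite (record_event_ancestor tn t0 (s01 y)).
rewrite /g; under eq_integral do rewrite -sumEFin -big_filter.
rewrite ge0_integral_sum //; last first.
  by move=> y; apply/measurable_EFinP; exact: measurable_funM.
rewrite big_filter.
apply: (@le_trans _ _
   (\sum_(y < n | (y < nlayered t)%N) ((k y)%:R^-1 / 8)%:E)%E); last first.
  apply: lee_sum => y yN.
  under eq_integral do rewrite EFinM.
  rewrite ge0_integralZl_EFin //; last exact/measurable_EFinP.
  rewrite integral_indic // setIT.
  have -> : (k y)%:R^-1 / 8 = 2^-1 * ((k y)%:R^-1 / 4) :> R.
    by field; rewrite pnatr_eq0 -lt0n.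
  rewrite [leLHS]EFinM.
  rewrite lee_pmul2l ?lte_fin //.
  apply: record_event_prob_ge => //; last exact: card_later_in_layer.
  by rewrite inE ltnn.
rewrite sumEFin lee_fin -mulr_suml harmonic_sum_blocks; last first.
  exact: ltnW (nlayered_lt tn t0).
have := harmonic_sum_pow2_ge R t; have : 0 <= t%:R :> R by [].
set h := \sum_(_ <= _ < _) _; nra.
Qed.

Theorem mainTheorem7 (R : realType) :
  exists (c : R) (n0 : nat), 0 < c /\
    forall n : nat, (n0 <= n)%N ->
      exists p : 'I_n -> R, is_distribution p /\
        forall (d : measure_display) (Omega : measurableType d)
          (P : probability Omega R) (delta : 'I_n -> {RV P >-> R}),
          mutually_independent delta ->
          (forall x, uniform01 (delta x)) ->
          ((c * log2 n%:R ^+ 2)%:E <= expected_depth p delta)%E.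
Proof.
(* 1600 = 16 * 10 ^ 2, from expected depth >= t ^ 2 / 16 and log2 n <= 10 t;
   32 <= n makes t positive. *)
exists (1600^-1), 32%N; split=> [|n n32]; first by rewrite invr_gt0 ltr0n.
pose T := trunc_log 2 n; pose t := (T %/ 5)%N.
have n0 : (0 < n)%N by apply: leq_trans n32.
have /andP[Tn nT] : (2 ^ T <= n < 2 ^ T.+1)%N by exact: trunc_log_bounds.
have T5 : (5 <= T)%N by apply: trunc_log_max.
have t0 : (0 < t)%N by rewrite divn_gt0.
have tn : (2 ^ (5 * t) <= n)%N.
  by apply: leq_trans Tn; rewrite leq_exp2l // mulnC leq_divM.
(* Since [T <= 5 * t + 4] and [1 <= t]. The successor matters because [n] is only known to be below
   [2 ^ T.+1]. *)
have Tt : (T.+1 <= 10 * t)%N by rewrite /t; lia.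
exists (layered R t); split=> [|d Omega P delta ind unif].
  exact: layered_distribution.
apply: le_trans (expected_depth_layered_ge tn t0 ind unif); rewrite lee_fin.
(* The sign allows squaring the upper bound [lnt]. *)
have ln0 : 0 <= log2 n%:R :> R.
  by rewrite -[0]/(0%:R) -(log2_exp2 R 0) ler_log2 // ?expr0 ?ler1n.
have lnt : log2 n%:R <= 10 * t%:R :> R.
  rewrite -[10 * t%:R](natrM R 10 t) -(log2_exp2 R (10 * t)).
  rewrite ler_log2 ?ltr0n // -natrX ler_nat.
  by apply: leq_trans (ltnW nT) _; rewrite leq_exp2l.
nra.
Qed.
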